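(* Assume: (h) $\mathsf A$ is an infinite compact subset of $\mathbb R^d$ for some $d\ge1$; (j) $c$ is bounded and there is $K_1\ge0$ with $|c(x,\tilde a)-c(x,a)|\le K_1 d_{\mathsf A}(\tilde a,a)$ for all $x\in\mathsf X$ and $a,\tilde a\in\mathsf A$; (k) there is $K_2\ge0$ with $\|p(\,\cdot\,|x,\tilde a)-p(\,\cdot\,|x,a)\|_{TV}\le K_2 d_{\mathsf A}(\tilde a,a)$ for all $x\in\mathsf X$ and $a,\tilde a\in\mathsf A$; (l) there exist constants $C>0$ and $\kappa\in(0,1)$ such that for every $\pi\in S$ there is a (necessarily unique) probability measure $\nu_\pi$ on $\mathsf X$ with $\|\lambda_n^{\pi,x}-\nu_\pi\|_{TV}\le C\kappa^n$ for all $x\in\mathsf X$ and $n\ge1$. Let $\pi\in S$ and let $\{\pi^k\}_{k\ge1}$ be the quantized approximations of $\pi$. Then for any $x\in\mathsf X$, all $k\ge1$ and all $n\ge1$, $$|w_A(\pi,x)-w_A(\pi^k,x)|\le 2MC\kappa^n+K_n(1/k)^{1/d},$$ where $K_n=(2n-1)K_2\alpha M+K_1\alpha$ and $M:=\sup_{(x,a)\in\mathsf X\times\mathsf A}|c(x,a)|$. (Here $K_1$, $K_2$ appearing in the formula for $K_n$ are the Lipschitz constants of (j) and (k).)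
   Context: Markov decision process: the state space $\mathsf X$ is a Polish space with its Borel $\sigma$-algebra, the action space $\mathsf A$ is as in (h); every action is admissible in every state; $p(\,\cdot\,|x,a)$ is a stochastic kernel on $\mathsf X$ given $\mathsf X\times\mathsf A$ (transition probability); the one-stage cost $c:\mathsf X\times\mathsf A\to[0,\infty)$ is measurable. ''Measurable'' means Borel measurable. $d_{\mathsf A}$ is the Euclidean distance on $\mathsf A$ inherited from $\mathbb R^d$. $\|\cdot\|_{TV}$ is the total variation norm; for probability measures, $\|\nu-\eta\|_{TV}=2\sup_{B}|\nu(B)-\eta(B)|$. A deterministic stationary policy $\pi$ is given (induced) by a measurable function $f:\mathsf X\to\mathsf A$: at each time $n$ the action is $a_n=f(x_n)$. $S$ denotes the set of all deterministic stationary policies. $E^\pi_x$ is expectation for the process $(x_0,a_0,x_1,a_1,\dots)$ with $x_0=x$, actions chosen by $\pi$, and $x_{n+1}\sim p(\,\cdot\,|x_n,a_n)$ given the past; $\lambda_n^{\pi,x}$ is the law of $x_n$ under it. Average cost: $w_A(\pi,x)=\limsup_{N\to\infty}\frac1NE^\pi_x\big[\sum_{n=0}^Nc(x_n,a_n)\big]$. Quantized approximations and the constant $\alpha$: since $\mathsf A$ is an infinite compact subset of $\mathbb R^d$, there are a constant $\alpha>0$ and finite sets $\Lambda_k\subset\mathsf A$ with $|\Lambda_k|=k$ such that $\max_{x\in\mathsf A}\min_{y\in\Lambda_k}d_{\mathsf A}(x,y)\le\alpha(1/k)^{1/d}$ for all $k\ge1$; fix such $\alpha$ and $\Lambda_k$.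 If $\pi\in S$ is induced by $f$, let $q_k:\mathsf X\to\Lambda_k$, $q_k(x)=\arg\min_{a\in\Lambda_k}d_{\mathsf A}(f(x),a)$, with ties broken so that $q_k$ is measurable; hence $\sup_{x\in\mathsf X}d_{\mathsf A}(q_k(x),f(x))\le\alpha(1/k)^{1/d}$. The policy $\pi^k\in S$ induced by $q_k$ is the ($k$-th) quantized approximation of $\pi$. *)

(* Defs.v *)
From HB Require Import structures.
From mathcomp Require Import all_boot all_order all_algebra.
From mathcomp Require Import all_classical all_reals all_analysis.
From mathcomp Require Import measurable_realfun.

Set Implicit Arguments.
Unset Strict Implicit.
Unset Printing Implicit Defensive.

Import Order.TTheory GRing.Theory Num.Theory.
Import numFieldNormedType.Exports.

Local Open Scope classical_set_scope.
Local Open Scope ring_scope.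

(* The Borel sigma-algebra of a topological space. *)
Notation borel T := (g_sigma_algebraType (@open T)).

Definition polish (R : realType) (T : topologicalType) : Prop :=
  (exists D : set T, countable D /\ dense D) /\
  exists dist : T -> T -> R,
    [/\ forall x y, dist x y = 0 <-> x = y,
        forall x y, dist x y = dist y x &
        forall x y z, dist x z <= dist x y + dist y z] /\
    (forall (x : T) (U : set T), nbhs x U <->
       exists2 e, 0 < e & [set y | dist x y < e] `<=` U) /\
    forall u : nat -> T,
      (forall e, 0 < e -> exists N, forall m n : nat,
         (N <= m)%N -> (N <= n)%N -> dist (u m) (u n) < e) ->
      exists l : T, u @ \oo --> l.

(* The library's norm on 'rV[R]_d is the sup norm, which induces the same
   topology but not the Euclidean distance. *)
Definition euclidean_dist (R : realType) (d : nat) (u v : 'rV[R]_d) : R :=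
  Num.sqrt (\sum_(i < d) (u 0 i - v 0 i) ^+ 2).

Section action_space.
Context (R : realType) (d : nat) (S : set 'rV[R]_d).

Definition action_dist (a b : set_type S) : R :=
  euclidean_dist (set_val a) (set_val b).

(* max_{a in S} min_{b in L} of the distance; for S compact and L finite and
   nonempty the supremum and the infimum are attained. *)
Definition covering_radius (L : set (set_type S)) : \bar R :=
  ereal_sup [set ereal_inf [set (action_dist a b)%:E | b in L]
            | a in [set: set_type S]].

Definition quantizes (X : Type) (L : set (set_type S))
    (f q : X -> set_type S) : Prop :=
  forall x, L (q x) /\
    forall b, L b -> action_dist (f x) (q x) <= action_dist (f x) b.

(* The type S with its subspace topology. Measurable types have to be
   inhabited, hence the dependence on the infiniteness of S. *)
Definition action (hS : infinite_set S) : Type := set_type S.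

Variable hS : infinite_set S.

Lemma action_inhabited : exists a : set_type S, True.
Proof.
have [a Sa] : S !=set0 by apply/set0P/eqP => S0; apply: hS; rewrite S0.
by exists (SigSub (mem_set Sa)).
Qed.

HB.instance Definition _ := Topological.copy (action hS) (set_type S).
HB.instance Definition _ :=
  isPointed.Build (action hS) (projT1 (cid action_inhabited)).

End action_space.

Section total_variation.
Context (d : measure_display) (T : measurableType d) (R : realType).

(* The total variation norm of mu - nu, for probability measures mu and nu. *)
Definition tv_dist (mu nu : set T -> \bar R) : R :=
  2 * sup [set `|fine (mu B) - fine (nu B)| | B in measurable].

End total_variation.

(* The process run from a given state under the stationary policy f. Its n-th
   history is the tuple (x_0, a_0), ..., (x_n, a_n), oldest first, where
   a_i = f x_i and x_{i+1} has law p (x_i, a_i) given the past. Everything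
   below involves finite horizons only, so the laws of the histories replace
   the law of the infinite trajectory. *)
Section decision_process.
Context (dX dA : measure_display) (X : measurableType dX)
  (A : measurableType dA) (R : realType).
Variables (p : R.-pker (X * A) ~> X) (f : {mfun X >-> A}).

Local Notation history n := ((n.+1).-tuple (X * A)%type).

Definition history_init (x : X) : history 0 := [tuple (x, f x)].

Definition history_extend n (h : history n) (y : X) : history n.+1 :=
  [tuple of rcons h (y, f y)].

Lemma measurable_history_init : measurable_fun [set: X] history_init.
Proof.
apply/measurable_fun_tnthP => i; rewrite (ord1 i).
apply: (eq_measurable_fun (fun x => (x, f x))) => //.
exact: measurable_fun_pair.
Qed.

Lemma measurable_history_extend n :
  measurable_fun [set: history n * X] (fun z => history_extend z.1 z.2).
Proof.
apply/measurable_fun_tnthP => i.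
have [ltin|] := ltnP i n.+1.
  apply: (eq_measurable_fun (fun z => tnth z.1 (Ordinal ltin))) => [z _|].
    by rewrite /= !(tnth_nth (z.2, f z.2)) /= nth_rcons size_tuple ltin.
  exact: measurableT_comp (measurable_tnth _) measurable_fst.
move=> leni; have ein : (i : nat) = n.+1.
  by apply/eqP; rewrite eqn_leq leni -ltnS ltn_ord.
apply: (eq_measurable_fun (fun z => (z.2, f z.2))) => [z _|].
  by rewrite /= (tnth_nth (z.2, f z.2)) /= nth_rcons size_tuple ein ltnn eqxx.
apply: measurable_fun_pair => //.
exact: measurableT_comp.
Qed.

Definition next_state n (h : history n) : {measure set X -> \bar R} :=
  p (tnth h ord_max).

Lemma measurable_next_state n U : measurable U ->
  measurable_fun [set: history n] (@next_state n ^~ U).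
Proof.
move=> mU.
exact: measurableT_comp (measurable_kernel p _ mU) (measurable_tnth _).
Qed.

HB.instance Definition _ n := isKernel.Build _ _ _ _ R (@next_state n)
  (@measurable_next_state n).

Lemma next_state_setT n (h : history n) : next_state h [set: X] = 1%E.
Proof. exact: prob_kernel. Qed.

HB.instance Definition _ n := Kernel_isProbability.Build _ _ _ _ R
  (@next_state n) (@next_state_setT n).

Definition history_step n :
    history n -> {measure set (history n.+1) -> \bar R} :=
  mkcomp (@next_state n) (kdirac (@measurable_history_extend n)).

HB.instance Definition _ n := Kernel.on (@history_step n).

Lemma history_step_setT n (h : history n) :
  history_step h [set: history n.+1] = 1%E.
Proof.
rewrite /history_step /mkcomp /= /kcomp.
under eq_integral do rewrite /kdirac /= diracT.
by rewrite integral_cst// mul1e next_state_setT.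
Qed.

HB.instance Definition _ n := Kernel_isProbability.Build _ _ _ _ R
  (@history_step n) (@history_step_setT n).

Section history_next.
Variables (n : nat) (k : R.-pker X ~> history n).

Definition history_next : X -> {measure set (history n.+1) -> \bar R} :=
  mkcomp_noparam k (@history_step n).

HB.instance Definition _ := Kernel.on history_next.

Lemma history_next_setT x : history_next x [set: history n.+1] = 1%E.
Proof.
rewrite /history_next /mkcomp_noparam /= /kcomp_noparam.
under eq_integral do rewrite history_step_setT.
by rewrite integral_cst// mul1e prob_kernel.
Qed.

HB.instance Definition _ := Kernel_isProbability.Build _ _ _ _ R
  history_next history_next_setT.

End history_next.

Fixpoint history_kernel n : R.-pker X ~> history n :=
  if n is m.+1 then history_next (history_kernel m)
  else kdirac measurable_history_init.

(* The law of the n-th history of the process started at x. *)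
Definition history_law n (x : X) : set (history n) -> \bar R :=
  history_kernel n x.

HB.instance Definition _ n x := Measure.on (@history_law n x).

Lemma history_law_setT n x : @history_law n x [set: history n] = 1%E.
Proof. exact: prob_kernel. Qed.

HB.instance Definition _ n x := Measure_isProbability.Build _ _ _
  (@history_law n x) (@history_law_setT n x).

(* The law of x_n. *)
Definition state_law n (x : X) : set X -> \bar R :=
  pushforward (@history_law n x) (fun h => (tnth h ord_max).1).

Variable c : X * A -> R.

Definition average_cost (x : X) : \bar R :=
  limn_esup (fun N : nat => (N%:R^-1)%:E *
    'E_(@history_law N x)[fun h => (\sum_(n < N.+1) c (tnth h n))%R])%E.

End decision_process.

Arguments history_law {dX dA X A R} p f n x _.

(* Main.v *)
From HB Require Import structures.
Require Import Defs.
From mathcomp Require Import all_boot all_order all_algebra.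
From mathcomp Require Import all_classical all_reals all_analysis.
From mathcomp Require Import measurable_realfun ring lra.

Set Implicit Arguments.
Unset Strict Implicit.
Unset Printing Implicit Defensive.

Import Order.TTheory GRing.Theory Num.Theory.
Import numFieldNormedType.Exports.

Local Open Scope classical_set_scope.
Local Open Scope ring_scope.

(** Let w(g) be the average cost of the policy g, M a bound for the cost and r
a bound for the distance between f and its quantization q.

Under g the law of x_n tends to the invariant measure nu_g, so the expected
one-stage costs tend to the integral of c(y, g y) under nu_g; hence so do their
Cesaro means, and w(g) is that integral ([average_cost_ergodic]). To compare
w(f) with w(q), pass through a finite horizon n:

  nu_f  ~  law of x_n under f  ~  law of x_n under q  ~  nu_q.

The two outer steps are geometric ergodicity at time n. In the middle step the
integrand changes by at most K1 r, and the law of x_n changes by at most n K2 r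
in total variation, because each transition adds at most K2 r to the distance
of the two laws and the common part of the transition does not increase it
([state_law_tv_dist]).

All three steps bound a difference of integrals of a function with values in
[0, M] under two probability measures. As the total variation norm is twice the
largest discrepancy on events, such a difference is at most M/2 times that norm
([Rintegral_tv_dist]). This factor 1/2, which using only the absolute value of
the function would lose, is what keeps the distance of the laws from doubling
at each transition. It also yields

  |w(f) - w(q)| <= M C kappa^n + K1 r + (M / 2) n K2 r

([average_cost_perturbation]), which implies the stated bound since n / 2 is at
most 2 n - 1. *)

(** * Total variation and integrals of bounded functions *)

Section total_variation.
Context (dT : measure_display) (T : measurableType dT) (R : realType).
Implicit Types mu nu : probability T R.

Lemma probability_fineK mu B : measurable B -> (fine (mu B))%:E = mu B.
Proof. by move=> mB; rewrite fineK ?fin_num_measure. Qed.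

Lemma tv_dist_event mu nu B : measurable B ->
  `|fine (mu B) - fine (nu B)| <= tv_dist mu nu / 2.
Proof.
move=> mB; rewrite /tv_dist mulrC mulKf ?pnatr_eq0//.
apply: ub_le_sup; last by exists B.
have prob01 (P : probability T R) A : measurable A -> 0 <= fine (P A) <= 1.
  move=> mA; rewrite fine_ge0//= -lee_fin probability_fineK//.
  exact: probability_le1.
exists 1 => _ [A mA <-]; rewrite ler_norml.
have /andP[? ?] := prob01 mu _ mA; have /andP[? ?] := prob01 nu _ mA.
by rewrite lerBrDr lerBlDr; apply/andP; split; lra.
Qed.

Lemma tv_dist_ge0 mu nu : 0 <= tv_dist mu nu.
Proof.
by have := le_trans (normr_ge0 _) (tv_dist_event mu nu measurable0); lra.
Qed.

Lemma tv_dist_le mu nu e :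
  (forall B, measurable B -> `|fine (mu B) - fine (nu B)| <= e / 2) ->
  tv_dist mu nu <= e.
Proof.
move=> munu; rewrite /tv_dist mulrC -ler_pdivlMr//.
apply: ge_sup => [|_ [B mB <-]]; last exact: munu.
by exists `|fine (mu setT) - fine (nu setT)|, setT.
Qed.

Lemma integrable_bounded mu (g : T -> R) M : measurable_fun setT g ->
  (forall x, 0 <= g x <= M) -> mu.-integrable setT (EFin \o g).
Proof.
move=> mg g0M; apply: (@le_integrable _ _ _ _ _ _ _ (EFin \o cst M)) => //.
- exact/measurable_EFinP.
- move=> x _; have /andP[g0 gM] := g0M x.
  by rewrite /= lee_fin !ger0_norm// (le_trans g0).
- exact: finite_measure_integrable_cst.
Qed.

(** By the layer cake formula the integral of g is the integral over r in [0, M]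
of the probability that g > r, and for each r the two measures of that event
differ by at most half the total variation. *)
Lemma Rintegral_tv_dist mu nu (g : T -> R) M : measurable_fun setT g ->
  (forall x, 0 <= g x <= M) ->
  `|\int[mu]_x g x - \int[nu]_x g x| <= M / 2 * tv_dist mu nu.
Proof.
move=> mg g0M.
have M0 : 0 <= M by have /andP[+ +] := g0M point; exact: le_trans.
pose X : {mfun T >-> R} := HB.pack g (isMeasurableFun.Build _ _ _ _ g mg).
have layer (P : probability T R) : (\int[P]_x (g x)%:E =
    \int[lebesgue_measure]_(r in `[0%R, M]) P (g @^-1` `]r, +oo[))%E.
  have := @ge0_expectation_ccdf _ _ _ P X (fun x => (andP (g0M x)).1).
  rewrite expectation_def => ->.
  rewrite [LHS]integral_mkcond [RHS]integral_mkcond.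
  apply: eq_integral => r _; rewrite !patchE !mem_setE !in_itv/= andbT.
  have [r0|//] := leP 0 r; have [//|Mr] := leP r M.
  rewrite /ccdf /distribution /pushforward /= -[RHS](measure0 P); congr (P _).
  rewrite -subset0 => x /=; rewrite in_itv/= andbT.
  by have /andP[_ gM] := g0M x; rewrite ltNge (le_trans gM (ltW Mr)).
have mlayer (P : probability T R) :
    measurable_fun (`[0%R, M] : set R) (fun r => P (g @^-1` `]r, +oo[)).
  by apply: measurable_funTS; exact: (@ccdf_measurable _ _ _ P X).
have mtail r : measurable (g @^-1` `]r, +oo[).
  by rewrite -[X in measurable X]setTI; exact: (mg measurableT).
(* P and Q stand for mu and nu in either order, so that both halves of the
   absolute value follow. *)
have half (P Q : probability T R) : tv_dist P Q = tv_dist mu nu ->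
    \int[P]_x g x <= \int[Q]_x g x + M / 2 * tv_dist mu nu.
  move=> PQ.
  have Pfin (P' : probability T R) : (\int[P']_x (g x)%:E)%E \is a fin_num.
    by apply: integrable_fin_num => //; exact: integrable_bounded g0M.
  rewrite -lee_fin EFinD /Rintegral !fineK//; try exact: Pfin.
  rewrite !layer.
  pose e := tv_dist P Q / 2.
  have e0 : 0 <= e by rewrite divr_ge0// tv_dist_ge0.
  have -> : (M / 2 * tv_dist mu nu)%:E =
      (\int[lebesgue_measure]_(r in (`[0%R, M] : set R)) (e%:E))%E.
    rewrite integral_cst//= lebesgue_measure_itv/= lte_fin.
    rewrite -PQ /e; have [_|Mlt0|<-] := ltgtP 0 M.
    + by rewrite -EFinB -EFinM subr0; congr EFin; lra.
    + by move: M0; rewrite leNgt Mlt0.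
    + by rewrite mule0 !mul0r.
  rewrite -ge0_integralD//; last exact: mlayer.
  apply: ge0_le_integral => //; first exact: mlayer.
    exact: (emeasurable_funD (mlayer Q) (measurable_cst _)).
  move=> r _.
  have := tv_dist_event P Q (mtail r); rewrite -/e ler_norml => /andP[_].
  by rewrite lerBlDr -lee_fin EFinD !probability_fineK// addeC.
have tv_sym : tv_dist nu mu = tv_dist mu nu.
  rewrite /tv_dist; congr (_ * sup _).
  by apply/seteqP; split => _ [B mB <-]; exists B => //; rewrite distrC.
by rewrite ler_distl lerBlDr !half.
Qed.

End total_variation.

(** * The law of the state process *)

Section kernel_composition.
Local Open Scope ereal_scope.
Context d0 d1 d2 (T0 : measurableType d0) (T1 : measurableType d1)
  (T2 : measurableType d2) (R : realType).

(** A kernel k2 from T1 is a kernel from T0 * T1 that ignores T0, which reduces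
this composition to the parameterized one. *)
Lemma ge0_integral_kcomp_noparam (k1 : R.-spker T0 ~> T1)
    (k2 : R.-spker T1 ~> T2) x (F : T2 -> \bar R) :
  (forall z, 0 <= F z) -> measurable_fun setT F ->
  \int[mkcomp_noparam k1 k2 x]_z F z = \int[k1 x]_y \int[k2 y]_z F z.
Proof. exact: (@integral_kcomp _ _ _ _ _ _ _ k1 (kernel.kernel_snd k2)). Qed.

End kernel_composition.

Section state_process.
Local Open Scope ereal_scope.
Context (dX dA : measure_display) (X : measurableType dX)
  (A : measurableType dA) (R : realType).
Variables (p : R.-pker (X * A) ~> X) (f : {mfun X >-> A}).

Local Notation history n := ((n.+1).-tuple (X * A)%type).

Lemma integral_history_law0 x (F : history 0 -> \bar R) :
  measurable_fun setT F ->
  \int[history_law p f 0 x]_h F h = F (history_init f x).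
Proof. by move=> mF; rewrite integral_dirac// diracT mul1e. Qed.

Lemma integral_history_lawS n x (F : history n.+1 -> \bar R) :
  (forall h, 0 <= F h) -> measurable_fun setT F ->
  \int[history_law p f n.+1 x]_h F h =
  \int[history_law p f n x]_h
    \int[p (tnth h ord_max)]_y F (history_extend f h y).
Proof.
move=> F0 mF.
rewrite [LHS](@ge0_integral_kcomp_noparam _ _ _ _ _ _ R
  (history_kernel p f n) (@history_step _ _ _ _ _ p f n))//.
apply: eq_integral => h _.
rewrite /history_step /mkcomp integral_kcomp//.
apply: eq_integral => y _.
by rewrite integral_dirac// diracT mul1e.
Qed.

Definition last_state {n} (h : history n) : X := (tnth h ord_max).1.

Lemma measurable_last_state n : measurable_fun setT (@last_state n).
Proof. exact: measurableT_comp measurable_fst (measurable_tnth _). Qed.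

HB.instance Definition _ n := isMeasurableFun.Build _ _ _ _
  (@last_state n) (@measurable_last_state n).

HB.instance Definition _ n x := Probability.copy (@state_law _ _ _ _ _ p f n x)
  (distribution (history_law p f n x) (@last_state n)).

Lemma ge0_integral_state_law n x (g : X -> \bar R) :
  (forall y, 0 <= g y) -> measurable_fun setT g ->
  \int[state_law p f n x]_y g y =
  \int[history_law p f n x]_h g (last_state h).
Proof.
move=> g0 mg; exact: (@ge0_integral_distribution _ _ _ _ _
  (history_law p f n x) (@last_state n) g mg g0).
Qed.

Lemma tnth_history_extend_max n (h : history n) y :
  tnth (history_extend f h y) ord_max = (y, f y).
Proof. by rewrite (tnth_nth (y, f y)) /= nth_rcons size_tuple ltnn eqxx. Qed.

(** Extending a history by a transition of total mass 1 does not change the law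
of its earlier steps, so the law of (x_i, a_i) does not depend on the horizon N;
and a_i = f x_i surely. *)
Lemma ge0_integral_step_law N (i : 'I_N.+1) x (F : X * A -> \bar R) :
  (forall z, 0 <= F z) -> measurable_fun setT F ->
  \int[history_law p f N x]_h F (tnth h i) =
  \int[state_law p f i x]_y F (y, f y).
Proof.
move=> F0 mF.
have mFf : measurable_fun setT (fun y => F (y, f y)).
  by apply: measurableT_comp => //; exact: measurable_fun_pair.
elim: N => [|N IHN] in i *.
  rewrite ord1 ge0_integral_state_law// !integral_history_law0//.
    exact: (measurableT_comp mFf (@measurable_last_state 0)).
  exact: (measurableT_comp mF (measurable_tnth _)).
have mFi := measurableT_comp mF (measurable_tnth i).
have [ltiN|] := ltnP i N.+1.
  rewrite integral_history_lawS// -(IHN (Ordinal ltiN)).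
  apply: eq_integral => h _.
  rewrite (_ : (fun y => _) = cst (F (tnth h (Ordinal ltiN)))); last first.
    apply/funext => y; congr F.
    by rewrite !(tnth_nth (y, f y)) /= nth_rcons size_tuple ltiN.
  by rewrite integral_cst// prob_kernel mule1.
rewrite leq_eqVlt ltnNge -ltnS ltn_ord orbF => /eqP Ni.
have -> : i = ord_max by exact/val_inj.
rewrite ge0_integral_state_law//= !integral_history_lawS//.
- apply: eq_integral => h _; apply: eq_integral => y _.
  by rewrite /last_state tnth_history_extend_max.
- exact: (measurableT_comp mFf (@measurable_last_state _)).
- exact: (measurableT_comp mF (measurable_tnth _)).
Qed.

(** The Chapman-Kolmogorov equation. *)
Lemma state_lawS n x B : measurable B ->
  state_law p f n.+1 x B = \int[state_law p f n x]_y p (y, f y) B.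
Proof.
move=> mB.
have mp : measurable_fun setT (p ^~ B) by exact: measurable_kernel.
rewrite -(ge0_integral_step_law ord_max x _ mp)//.
transitivity (\int[state_law p f n.+1 x]_y (\1_B y)%:E).
  by rewrite integral_indic// setIT.
have m1B : measurable_fun setT (fun y : X => (\1_B y : R)%:E).
  exact/measurable_EFinP.
rewrite ge0_integral_state_law ?integral_history_lawS//; last first.
  exact: (measurableT_comp m1B (@measurable_last_state _)).
apply: eq_integral => h _.
under eq_integral do rewrite /last_state tnth_history_extend_max.
by rewrite integral_indic// setIT.
Qed.

End state_process.

(** * Dependence of the state laws on the policy *)

Lemma Rintegral_perturb dT (T : measurableType dT) (R : realType)
    (mu nu : probability T R) (g h : T -> R) M e :
  measurable_fun setT g -> measurable_fun setT h ->
  (forall x, 0 <= g x <= M) -> (forall x, 0 <= h x <= M) ->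
  (forall x, `|g x - h x| <= e) ->
  `|\int[mu]_x g x - \int[nu]_x h x| <= e + M / 2 * tv_dist mu nu.
Proof.
move=> mg mh g0M h0M ghe.
have ig := integrable_bounded mu mg g0M.
have ih := integrable_bounded mu mh h0M.
rewrite (le_trans (ler_distD (\int[mu]_x h x) _ _))// lerD//; last first.
  exact: Rintegral_tv_dist.
have igh : mu.-integrable setT (EFin \o (fun x => g x - h x)).
  exact: (integrableB measurableT ig ih).
rewrite -RintegralB// (le_trans (le_normr_Rintegral _ _))//.
rewrite -[e in _ <= e]mulr1 -(_ : fine (mu setT) = 1); last first.
  by rewrite probability_setT.
rewrite -Rintegral_cst//; apply: le_Rintegral => //.
- exact: (integrable_norm igh).
- exact: finite_measure_integrable_cst.
Qed.

Section perturbed_policy.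
Context (dX dA : measure_display) (X : measurableType dX)
  (A : measurableType dA) (R : realType).
Variables (p : R.-pker (X * A) ~> X).

(** [p z] under a name that can carry the structure of a probability measure. *)
Definition transition_prob (z : X * A) : set X -> \bar R := p z.

HB.instance Definition _ z := Measure.on (transition_prob z).

Lemma transition_prob_setT z : transition_prob z setT = 1%E.
Proof. exact: prob_kernel. Qed.

HB.instance Definition _ z := Measure_isProbability.Build _ _ _
  (transition_prob z) (transition_prob_setT z).

Lemma measurable_graph (f : {mfun X >-> A}) :
  measurable_fun setT (fun y => (y, f y)).
Proof. exact: measurable_fun_pair. Qed.

Lemma fine_state_lawS (f : {mfun X >-> A}) n x B : measurable B ->
  fine (state_law p f n.+1 x B) =
  \int[state_law p f n x]_y fine (p (y, f y) B).
Proof.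
move=> mB; rewrite state_lawS// /Rintegral; congr fine.
apply: eq_integral => y _.
by rewrite (probability_fineK (transition_prob (y, f y))).
Qed.

(** In one transition from y the probabilities of an event B under f and g
differ by at most e / 2, and y |-> p (y, g y) B has values in [0, 1], so that
changing the law of y from one state law to the other costs at most half of
their distance. Hence the distance grows by at most e. *)
Lemma state_law_tv_dist (f g : {mfun X >-> A}) e :
  (forall y, tv_dist (p (y, f y)) (p (y, g y)) <= e) ->
  forall n x, tv_dist (state_law p f n x) (state_law p g n x) <= n%:R * e.
Proof.
move=> pfg; elim=> [|n IHn] x; apply: tv_dist_le => B mB.
  rewrite [X in `|X|](_ : _ = 0) ?normr0 ?mul0r//; exact: subrr.
have p01 z : 0 <= fine (p z B) <= 1.
  rewrite fine_ge0//= -lee_fin.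
  rewrite (probability_fineK (transition_prob z))//.
  exact: (probability_le1 (transition_prob z)).
have mp (k : {mfun X >-> A}) :
    measurable_fun setT (fun y => fine (p (y, k y) B)).
  apply: measurableT_comp => //.
  exact: (measurableT_comp (measurable_kernel p B mB) (measurable_graph k)).
rewrite !fine_state_lawS//.
apply: (le_trans (@Rintegral_perturb _ _ _ (state_law p f n x)
  (state_law p g n x) _ _ 1 (e / 2) (mp f) (mp g) _ _ _)) => // [y|].
  apply: le_trans (tv_dist_event (transition_prob (y, f y))
    (transition_prob (y, g y)) mB) _.
  by rewrite ler_pM2r ?invr_gt0//; exact: pfg.
have := IHn x; lra.
Qed.

End perturbed_policy.

(** * The average cost of an ergodic policy *)

(** The average cost divides a sum of N + 1 terms by N; the extra term
contributes a N / N, which tends to 0. *)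
Lemma cvg_cesaro_extra_term (R : realType) (a : nat -> R) (l : R) :
  a @ \oo --> l ->
  (fun N => N%:R^-1 * \sum_(n < N.+1) a n) @ \oo --> l.
Proof.
move=> al; rewrite -cvg_shiftS.
rewrite (_ : [sequence _]_n =
    arithmetic_mean a \+ harmonic \* (fun n => a n.+1)).
  have h0 : harmonic \* (fun n => a n.+1) @ \oo --> (0 * l : R).
    by apply: cvgM; [exact: cvg_harmonic|rewrite (cvg_shiftS a)].
  by have := cvgD (cesaro al) h0; rewrite mul0r addr0; exact.
apply/funext => N /=; rewrite big_ord_recr mulrDr /=.
by rewrite /arithmetic_mean /= seriesEord.
Qed.

Section ergodic_average.
Context (dX dA : measure_display) (X : measurableType dX)
  (A : measurableType dA) (R : realType).
Variables (p : R.-pker (X * A) ~> X) (f : {mfun X >-> A}).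
Variables (c : X * A -> R) (M : R).
Hypotheses (mc : measurable_fun setT c) (c0M : forall z, 0 <= c z <= M).

Lemma measurable_policy_cost : measurable_fun setT (fun y => c (y, f y)).
Proof. exact: (measurableT_comp mc (measurable_graph f)). Qed.

Lemma expected_total_cost N x :
  ('E_(history_law p f N x)[fun h => (\sum_(n < N.+1) c (tnth h n))%R] =
   (\sum_(n < N.+1) \int[state_law p f n x]_y c (y, f y))%R%:E)%E.
Proof.
rewrite unlock /=.
under eq_integral do rewrite -sumEFin.
have mcE : measurable_fun setT (EFin \o c) by exact/measurable_EFinP.
have c0 z : (0 <= (c z)%:E)%E by rewrite lee_fin; have /andP[] := c0M z.
rewrite ge0_integral_sum//; last first.
  by move=> i; exact: (measurableT_comp mcE (measurable_tnth i)).
rewrite -sumEFin; apply: eq_bigr => i _.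
rewrite (@ge0_integral_step_law _ _ _ _ _ p f N i x (EFin \o c))//.
rewrite /Rintegral fineK//.
apply: (@integrable_fin_num _ _ _ (state_law p f i x)) => //.
apply: (@integrable_bounded _ _ _ _ _ M) => //; exact: measurable_policy_cost.
Qed.

Lemma average_cost_ergodic (nu : probability X R) x :
  tv_dist (state_law p f n x) nu @[n --> \oo] --> (0 : R) ->
  average_cost p f c x = (\int[nu]_y c (y, f y))%:E.
Proof.
move=> tv0.
have cost_cvg : (\int[state_law p f n x]_y c (y, f y)) @[n --> \oo] -->
    \int[nu]_y c (y, f y).
  apply/subr_cvg0/norm_cvg0P.
  have bound0 :
      (M / 2 * tv_dist (state_law p f n x) nu) @[n --> \oo] --> (0 : R).
    by rewrite -(mulr0 (M / 2)); apply: cvgM => //; exact: cvg_cst.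
  apply: (squeeze_cvgr _ (cvg_cst 0) bound0); apply: nearW => n.
  rewrite normr_ge0/=; apply: Rintegral_tv_dist => //.
  exact: measurable_policy_cost.
rewrite /average_cost; under eq_fun do rewrite expected_total_cost -EFinM.
apply: (cvg_limn_einf_sup _).2; apply: cvg_EFin; first exact: nearW.
exact: (cvg_cesaro_extra_term cost_cvg).
Qed.

End ergodic_average.

(** * Comparison of two policies *)

Lemma ler_dist_chain (R : realDomainType) (a b u v r s t : R) :
  `|a - u| <= r -> `|a - b| <= s -> `|b - v| <= t -> `|u - v| <= r + s + t.
Proof.
rewrite !ler_norml => /andP[? ?] /andP[? ?] /andP[? ?].
by apply/andP; split; lra.
Qed.

Section policy_comparison.
Context (dX dA : measure_display) (X : measurableType dX)
  (A : measurableType dA) (R : realType).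
Variables (p : R.-pker (X * A) ~> X) (c : X * A -> R) (M C kappa : R).
Hypotheses (mc : measurable_fun setT c) (c0M : forall z, 0 <= c z <= M).
Hypothesis (kappa01 : 0 < kappa < 1).

Definition geometrically_ergodic (f : {mfun X >-> A}) (nu : probability X R) :=
  forall x n, (1 <= n)%N -> tv_dist (state_law p f n x) nu <= C * kappa ^+ n.

Lemma geometrically_ergodic_average_cost (f : {mfun X >-> A})
    (nu : probability X R) x :
  geometrically_ergodic f nu ->
  average_cost p f c x = (\int[nu]_y c (y, f y))%:E.
Proof.
have /andP[kappa0 kappa1] := kappa01.
move=> fnu; apply: (average_cost_ergodic mc c0M).
have Ckappa0 : (C * kappa ^+ n) @[n --> \oo] --> (0 : R).
  rewrite -(mulr0 C); apply: cvgM; first exact: cvg_cst.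
  by apply: cvg_expr; rewrite gtr0_norm.
apply: (squeeze_cvgr _ (cvg_cst 0) Ckappa0); near=> n.
rewrite tv_dist_ge0/=; apply: fnu.
by near: n; exists 1%N.
Unshelve. all: by end_near. Qed.

(** The three summands are the two ergodic approximations at time n, each worth
M / 2 * C * kappa ^+ n, the change of the cost, and the change of the law of
x_n. *)
Lemma average_cost_perturbation (f g : {mfun X >-> A})
    (nu_f nu_g : probability X R) e_c e_p x n :
  geometrically_ergodic f nu_f -> geometrically_ergodic g nu_g ->
  (forall y, `|c (y, f y) - c (y, g y)| <= e_c) ->
  (forall y, tv_dist (p (y, f y)) (p (y, g y)) <= e_p) ->
  (1 <= n)%N ->
  (`| average_cost p f c x - average_cost p g c x | <=
     (M * C * kappa ^+ n + e_c + M / 2 * n%:R * e_p)%:E)%E.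
Proof.
move=> ergf ergg cfg pfg n1.
have M0 : 0 <= M by have /andP[+ +] := c0M point; exact: le_trans.
rewrite (geometrically_ergodic_average_cost x ergf).
rewrite (geometrically_ergodic_average_cost x ergg).
rewrite -EFinB lee_fin.
have mcf h := measurable_policy_cost h mc.
have stationary (h : {mfun X >-> A}) nu : geometrically_ergodic h nu ->
    `|\int[state_law p h n x]_y c (y, h y) - \int[nu]_y c (y, h y)| <=
    M / 2 * (C * kappa ^+ n).
  move=> ergh.
  apply: (le_trans (@Rintegral_tv_dist _ _ _ _ _ _ M (mcf h) _)) => //.
  by apply: ler_wpM2l; [rewrite divr_ge0|exact: ergh].
have horizon : `|\int[state_law p f n x]_y c (y, f y) -
    \int[state_law p g n x]_y c (y, g y)| <= e_c + M / 2 * (n%:R * e_p).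
  apply: (le_trans (@Rintegral_perturb _ _ _ _ _ _ _ M e_c
    (mcf f) (mcf g) _ _ _)) => //.
  rewrite lerD2l; apply: ler_wpM2l; first by rewrite divr_ge0.
  exact: state_law_tv_dist.
apply: le_trans (ler_dist_chain (stationary _ _ ergf) horizon
  (stationary _ _ ergg)) _.
by rewrite le_eqVlt; apply/orP; left; apply/eqP; field.
Qed.

End policy_comparison.


(** * Quantized policies *)

Lemma quantizes_action_dist (R : realType) (d : nat) (S : set 'rV[R]_d)
    (X : Type) (L : set (set_type S)) (f q : X -> set_type S) (r : R) :
  (covering_radius L <= r%:E)%E -> quantizes L f q ->
  forall x, action_dist (f x) (q x) <= r.
Proof.
move=> Lr qf x; have [_ qmin] := qf x; rewrite -lee_fin.
apply: (le_trans _ (le_trans _ Lr)); last first.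
  by apply: ereal_sup_ubound; exists (f x).
by apply: le_ereal_inf_tmp => _ [b Lb <-]; rewrite lee_fin qmin.
Qed.

Unset Implicit Arguments.

Theorem mainTheorem4 (R : realType)
    (* state space *)
    (T : ptopologicalType) (hT : polish R T)
    (* (h): action space *)
    (d : nat) (hd : (1 <= d)%N)
    (S : set 'rV[R]_d) (Scompact : compact S) (Sinf : infinite_set S)
    (* transition probability and one-stage cost *)
    (p : R.-pker (borel T * borel (action Sinf)) ~> borel T)
    (c : borel T * borel (action Sinf) -> R)
    (c_measurable : measurable_fun setT c)
    (c_ge0 : forall z, 0 <= c z)
    (* (j) *)
    (c_bounded : exists B : R, forall z, `|c z| <= B)
    (K1 : R) (K1_ge0 : 0 <= K1)
    (c_lip : forall (x : borel T) (a b : borel (action Sinf)),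
      `|c (x, b) - c (x, a)| <= K1 * action_dist b a)
    (* (k) *)
    (K2 : R) (K2_ge0 : 0 <= K2)
    (p_lip : forall (x : borel T) (a b : borel (action Sinf)),
      tv_dist (p (x, b)) (p (x, a)) <= K2 * action_dist b a)
    (* (l) *)
    (C kappa : R) (C_gt0 : 0 < C) (kappa_gt0 : 0 < kappa) (kappa_lt1 : kappa < 1)
    (ergodic : forall g : {mfun borel T >-> borel (action Sinf)},
      exists nu : probability (borel T) R,
        forall (x : borel T) (n : nat), (1 <= n)%N ->
          tv_dist (state_law p g n x) nu <= C * kappa ^+ n)
    (* the grids *)
    (alpha : R) (alpha_gt0 : 0 < alpha) (Lambda : nat -> set (action Sinf))
    (Lambda_card : forall k, (1 <= k)%N -> (Lambda k #= `I_k)%card)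
    (Lambda_net : forall k, (1 <= k)%N ->
      (covering_radius (Lambda k) <=
         (alpha * (k%:R^-1) `^ (d%:R^-1))%:E)%E)
    (* a stationary policy and its quantized approximations *)
    (f : {mfun borel T >-> borel (action Sinf)})
    (q : nat -> {mfun borel T >-> borel (action Sinf)})
    (hq : forall k, (1 <= k)%N -> quantizes (Lambda k) f (q k))
    (x : borel T) (k : nat) (hk : (1 <= k)%N) (n : nat) (hn : (1 <= n)%N) :
  let M := sup [set `|c z| | z in setT] in
  let K_n := (2 * n%:R - 1) * K2 * alpha * M + K1 * alpha in
  (`| average_cost p f c x - average_cost p (q k) c x | <=
     (2 * M * C * kappa ^+ n + K_n * (k%:R^-1) `^ (d%:R^-1))%:E)%E.
Proof.
cbv zeta; set M := sup _.
have c0M z : 0 <= c z <= M.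
  rewrite c_ge0 -[c z]ger0_norm//; apply: ub_le_sup; last by exists z.
  by have [B cB] := c_bounded; exists B => _ [y _ <-].
have M0 : 0 <= M by have /andP[+ +] := c0M point; exact: le_trans.
have [nu_f ergf] := ergodic f; have [nu_q ergq] := ergodic (q k).
pose r : R := (k%:R^-1) `^ (d%:R^-1).
have r0 : 0 <= r by exact: powR_ge0.
have fq y : action_dist (f y) (q k y) <= alpha * r.
  exact: quantizes_action_dist (Lambda_net k hk) (hq k hk) y.
apply: le_trans (average_cost_perturbation (e_c := K1 * (alpha * r))
  (e_p := K2 * (alpha * r)) c_measurable c0M _ x ergf ergq _ _ hn) _.
- by rewrite kappa_gt0.
- by move=> y; apply: le_trans (c_lip y _ _) _; exact: ler_wpM2l.
- by move=> y; apply: le_trans (p_lip y _ _) _; exact: ler_wpM2l.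
rewrite lee_fin -/r.
have n1 : 1 <= n%:R :> R by rewrite ler1n.
have MC0 : 0 <= M * C * kappa ^+ n.
  by rewrite mulr_ge0 ?exprn_ge0 ?mulr_ge0// ltW.
have P0 : 0 <= M * (K2 * (alpha * r)).
  by rewrite !mulr_ge0// ltW.
(* n / 2 <= 2 n - 1 because 1 <= n *)
have nP : M / 2 * n%:R * (K2 * (alpha * r)) <=
    (2 * n%:R - 1) * (M * (K2 * (alpha * r))).
  rewrite (_ : M / 2 * _ * _ = n%:R / 2 * (M * (K2 * (alpha * r)))); last by field.
  by apply: ler_wpM2r => //; lra.
move: MC0 nP; lra.
Qed.
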